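(* Consider a finite-horizon LQ game with $N$ agents and losses $J^1,\dots,J^N$, under any one of the information structures (i) open-loop, (ii) full-state linear feedback, (iii) decoupled state linear feedback described in the context, with decision variables $\gamma^i_t\in\mathbb{R}^{q^i}$. The game is a potential game if and only if for all $i,j\in\{1,\dots,N\}$, all $t,\tau\in\{0,\dots,t_f-1\}$, and all values of the decision variables (in particular all $\gamma^i_t\in\mathbb{R}^{q^i}$, $\gamma^j_\tau\in\mathbb{R}^{q^j}$), $$\frac{\partial^2 J^i(\gamma)}{\partial \gamma^j_\tau\,\partial\gamma^i_t}=\frac{\partial^2 J^j(\gamma)}{\partial \gamma^j_\tau\,\partial\gamma^i_t}.$$
   Context: LQ game. There are $N$ agents, a horizon $t_f\ge 1$, states $x_t\in\mathbb{R}^n$ and scalar actions $u^i_t\in\mathbb{R}$, with dynamics $x_{t+1}=Ax_t+\sum_{i=1}^N B^iu^i_t$ for $t\in\{0,\dots,t_f-1\}$ and random initial state $x_0\sim\mathcal{D}$. Agent $i$ has decision variables $\gamma^i_t\in\mathbb{R}^{q^i}$, $\gamma^i=(\gamma^i_0,\dots,\gamma^i_{t_f-1})\in\mathbb{R}^{t_fq^i}$, and $\gamma=(\gamma^1,\dots,\gamma^N)$; $\gamma^{-i}$ denotes the decision variables of all agents other than $i$. The real-valued loss of agent $i$ is $$J^i(\gamma)=\mathbb{E}_{x_0\sim\mathcal{D}}\Big[\sum_{t=0}^{t_f}(x_t-d_t)^TQ^i_t(x_t-d_t)+\sum_{t=0}^{t_f-1}\sum_{j=1}^N\sum_{h=1}^N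 (u^j_t)^T(R^i_t)_{jh}u^h_t\Big],$$ where $d_t\in\mathbb{R}^n$ is a desired state, $Q^i_t\in\mathbb{R}^{n\times n}$ is positive semi-definite, $(R^i_t)_{jh}=(R^i_t)_{hj}\in\mathbb{R}$, $(R^i_t)_{ll}\ge 0$ for $l\ne i$, and $(R^i_t)_{ii}>0$. Information structures: (i) open-loop: $\gamma^i_t=u^i_t\in\mathbb{R}$, $q^i=1$; (ii) full-state linear feedback: $\gamma^i_t=K^i_t\in\mathbb{R}^n$ with $u^i_t=-K^i_tx_t$, $q^i=n$; (iii) decoupled state linear feedback: the state is partitioned as $x_t=(x^1_t,\dots,x^N_t)$ with $x^i_t\in\mathbb{R}^{n^i}$, $\sum_i n^i=n$, and $\gamma^i_t=k^i_t\in\mathbb{R}^{n^i}$ with $u^i_t=-k^i_tx^i_t$, $q^i=n^i$. Potential game: the game is potential if and only if there exists a function $\Pi$ of $\gamma$, real-valued, such that for every $i$, every $\gamma^{-i}$ and all $\gamma^i,\hat\gamma^i\in\mathbb{R}^{t_fq^i}$, $J^i(\gamma^i,\gamma^{-i})-J^i(\hat\gamma^i,\gamma^{-i})=\Pi(\gamma^i,\gamma^{-i})-\Pi(\hat\gamma^i,\gamma^{-i})$. Convention: $\frac{\partial^2 J}{\partial\gamma^j_\tau\partial\gamma^i_t}\in\mathbb{R}^{q^i\times q^j}$ is the matrix of mixed second partial derivatives, rows indexed by the components of $\gamma^i_t$ and columns by those of $\gamma^j_\tau$. *)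

(* Defs.v *)
From HB Require Import structures.
From mathcomp Require Import all_boot all_order all_algebra.
From mathcomp Require Import all_classical all_reals all_analysis.
Import Order.TTheory GRing.Theory Num.Theory.
Import numFieldNormedType.Exports.

Set Implicit Arguments.
Unset Strict Implicit.
Unset Printing Implicit Defensive.

Local Open Scope classical_set_scope.
Local Open Scope ring_scope.

Definition qform (R : realType) (n : nat) (Q : 'M[R]_n) (x : 'cV[R]_n) : R :=
  (x^T *m Q *m x) ord0 ord0.

(* Symmetry of Q is not required: symmetric positive semi-definite matrices
   are a special case. *)
Definition psd (R : realType) (n : nat) (Q : 'M[R]_n) : Prop :=
  forall x : 'cV[R]_n, 0 <= qform Q x.

(* R^n is n.-tuple R in the law of the initial state, because tuples carry the
   product (i.e. Borel) sigma-algebra, and 'cV[R]_n everywhere else. *)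
Record lq_game (R : realType) (N n tf : nat) := LQGame {
  dynA : 'M[R]_n ;
  dynB : 'I_N -> 'cV[R]_n ;
  init_law : probability (n.-tuple R) R ;
  target : 'I_tf.+1 -> 'cV[R]_n ;
  Qcost : 'I_N -> 'I_tf.+1 -> 'M[R]_n ;
  Rcost : 'I_N -> 'I_tf -> 'M[R]_N ;
  Qcost_psd : forall i t, psd (Qcost i t) ;
  Rcost_sym : forall i t j h, Rcost i t j h = Rcost i t h j ;
  Rcost_ge0 : forall i t l, l != i -> 0 <= Rcost i t l l ;
  Rcost_gt0 : forall i t, 0 < Rcost i t i i
}.

Inductive info_structure (N n : nat) :=
| OpenLoop
| FullState
| Decoupled (m : 'I_N -> nat) of (\sum_i m i = n)%N.

Definition qdim (N n : nat) (I : info_structure N n) (i : 'I_N) : nat :=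
  match I with
  | OpenLoop => 1%N
  | FullState => n
  | Decoupled m _ => m i
  end.

Definition action (R : realType) (N n : nat) (I : info_structure N n)
    (i : 'I_N) : 'rV[R]_(qdim I i) -> 'cV[R]_n -> R :=
  match I as I0 return 'rV[R]_(qdim I0 i) -> 'cV[R]_n -> R with
  | OpenLoop => fun u _ => u ord0 ord0
  | FullState => fun K x => - (K *m x) ord0 ord0
  | Decoupled m e => fun k x =>
      - (k *m submxcol (castmx (esym e, erefl 1%N) x) i) ord0 ord0
  end.

(* Row t of the matrix g i is the decision variable of agent i at time t. *)
Definition profile (R : realType) (N n tf : nat) (I : info_structure N n) :=
  forall i : 'I_N, 'M[R]_(tf, qdim I i).

Section Game.
Variables (R : realType) (N n tf : nat).
Variables (G : lq_game R N n tf) (I : info_structure N n).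
Local Notation profile := (profile R tf I).

(* Times are natural numbers in the recursion on the state; the value 0 at
   times t >= tf is never used by the cost. *)
Definition control (g : profile) (i : 'I_N) (t : nat) (x : 'cV[R]_n) : R :=
  if insub t is Some s then action (row s (g i)) x else 0.

Fixpoint state (g : profile) (x0 : 'cV[R]_n) (t : nat) : 'cV[R]_n :=
  if t is s.+1 then
    let x := state g x0 s in
    dynA G *m x + \sum_(i < N) control g i s x *: dynB G i
  else x0.

Definition input (g : profile) (x0 : 'cV[R]_n) (i : 'I_N) (t : nat) : R :=
  control g i t (state g x0 t).

Definition pathwise_cost (i : 'I_N) (g : profile) (x0 : n.-tuple R) : R :=
  let z : 'cV[R]_n := \col_k tnth x0 k in
  \sum_(t < tf.+1) qform (Qcost G i t) (state g z t - target G t) +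
  \sum_(t < tf) \sum_(j < N) \sum_(h < N)
    input g z j t * Rcost G i t j h * input g z h t.

(* The expectations defining the losses exist and are finite. *)
Definition real_valued_losses : Prop :=
  forall (i : 'I_N) (g : profile),
    (init_law G).-integrable setT (EFin \o pathwise_cost i g).

Definition loss (i : 'I_N) (g : profile) : R :=
  fine 'E_(init_law G)[pathwise_cost i g].

(* dfwith g i x is (x, g^-i). *)
Definition potential_game : Prop :=
  exists Pi : profile -> R,
    forall (i : 'I_N) (g : profile) (x y : 'M[R]_(tf, qdim I i)),
      loss i (dfwith g i x) - loss i (dfwith g i y) =
      Pi (dfwith g i x) - Pi (dfwith g i y).

Definition partial (F : profile -> R) (i : 'I_N) (t : 'I_tf)
    (a : 'I_(qdim I i)) (g : profile) : R :=
  'D_(delta_mx t a) (fun x : 'M[R]_(tf, qdim I i) => F (dfwith g i x)) (g i).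

(* d^2 F / (d gamma^j_tau d gamma^i_t), differentiating first in gamma^i_t. *)
Definition mixed_hessian (F : profile -> R) (j : 'I_N) (tau : 'I_tf)
    (i : 'I_N) (t : 'I_tf) (g : profile) : 'M[R]_(qdim I i, qdim I j) :=
  \matrix_(a, b) partial (partial F t a) tau b g.

End Game.

(* Main.v *)
(* Moving a single entry of gamma^i_t at a single time t moves the state affinely,
   because x_0, .., x_t do not change and the later inputs are affine in the
   state. Hence every pathwise cost, and after integration every loss, is
   quadratic along each coordinate line, its partial derivatives are exact central
   differences, and the Hessian condition becomes an identity between second
   differences. If it holds, then J^i - J^j is, for fixed other gains, a function
   of gamma^i plus a function of gamma^j (the four-cycle condition of Monderer and
   Shapley), and letting the agents switch from gain 0 to their own gain one after
   the other, each being charged its own loss difference, defines a potential. *)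
Require Import Defs.
From mathcomp Require Import all_boot all_order all_algebra.
From mathcomp Require Import all_classical all_reals all_analysis.
From mathcomp Require Import ring lra.
Import Order.TTheory GRing.Theory Num.Theory.
Import numFieldNormedType.Exports.

Set Implicit Arguments.
Unset Strict Implicit.
Unset Printing Implicit Defensive.

Local Open Scope classical_set_scope.
Local Open Scope ring_scope.

(** * Quadratic functions of one real variable *)

Section Quadratic.
Variable R : realType.
Implicit Types f : R -> R.

(** Interpolation at the nodes -1, 0 and 1: the coefficients of a polynomial of degree at most two
    are expressed through its values. *)
Definition quadratic f :=
  forall s, f s = f 0 + s * ((f 1 - f (-1)) / 2)
                  + s ^+ 2 * ((f 1 + f (-1)) / 2 - f 0).

Lemma quadraticP f :
  quadratic f <-> exists c0 c1 c2, forall s, f s = c0 + s * c1 + s ^+ 2 * c2.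
Proof.
split=> [fq|[c0 [c1 [c2 fE]]] s]; first by do 3!eexists.
by rewrite !fE; field.
Qed.

Lemma quadraticD (f1 f2 : R -> R) :
  quadratic f1 -> quadratic f2 -> quadratic (fun s => f1 s + f2 s).
Proof. by move=> q1 q2 s; rewrite q1 q2; field. Qed.

Lemma quadratic_sum (T : Type) (r : seq T) (F : T -> R -> R) :
  (forall i, quadratic (F i)) -> quadratic (fun s => \sum_(i <- r) F i s).
Proof.
move=> Fq; apply/quadraticP; elim: r => [|i r [c0 [c1 [c2 IH]]]].
  by exists 0, 0, 0 => s; rewrite big_nil; ring.
have /quadraticP[d0 [d1 [d2 FE]]] := Fq i.
exists (d0 + c0), (d1 + c1), (d2 + c2) => s.
by rewrite big_cons IH FE; ring.
Qed.

Lemma quadratic_stationary f : quadratic f ->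
  (forall s, f (s + 1) = f (s - 1)) -> forall s, f s = f 0.
Proof.
move=> /quadraticP[c0 [c1 [c2 fE]]] f_stat s.
(* The difference [f (s + 1) - f (s - 1)] is [2 * c1 + 4 * s * c2], so its vanishing at 0 and 1
   kills both coefficients. *)
have := f_stat 0; have := f_stat 1; rewrite !fE => h1 h0.
have -> : c1 = 0 by lra.
have -> : c2 = 0 by lra.
by ring.
Qed.

(** The difference quotient with step [h] is exactly [c1 + h * c2], and [c1] is the central
    difference with step 1. *)
Lemma derive_quadratic (V : normedModType R) (F : V -> R) (a v : V) :
  quadratic (fun s => F (a + s *: v)) ->
  'D_v F a = (F (a + v) - F (a - v)) / 2.
Proof.
move=> Fq; set c1 := _ / 2; set c2 := (F (a + v) + F (a - v)) / 2 - F a.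
have FE s : F (a + s *: v) = F a + s * c1 + s ^+ 2 * c2.
  by have := Fq s; rewrite /= scale0r addr0 scale1r scaleN1r.
apply: cvg_lim => //; apply: (@cvg_trans _ ((fun h => c1 + h * c2) @ 0^')).
  apply: near_eq_cvg; near=> h.
  have h0 : h != 0 by near: h; exact: nbhs_dnbhs_neq.
  by rewrite /= [_ *: v + a]addrC FE /GRing.scale /=; field.
suff: c1 + h * c2 @[h --> 0^'] --> c1 + 0 * c2 by rewrite mul0r addr0.
apply: cvgD; first exact: cvg_cst.
by apply: cvgMr_tmp; exact: nbhs_dnbhs.
Unshelve. all: by end_near. Qed.

End Quadratic.

(** * Moves of single gain entries *)

Section Shift.
Variables (R : realType) (N n tf : nat) (I : info_structure N n).
Local Notation profile := (profile R tf I).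
Implicit Types (g : profile) (F : profile -> R).

Definition gain_shift (i : 'I_N) (t : 'I_tf) (a : 'I_(qdim I i)) (s : R) g
    : profile :=
  dfwith g i (g i + s *: delta_mx t a).

Lemma profileP g g' : (forall k, g k = g' k) -> g = g'.
Proof. by move=> gg'; apply: functional_extensionality_dep. Qed.

Lemma dfwith_id g i : dfwith g i (g i) = g.
Proof. by apply: profileP => k; case: dfwithP. Qed.

Lemma dfwith_dfwith g i x y : dfwith (dfwith g i x) i y = dfwith g i y.
Proof.
apply: profileP => k; case: (eqVneq i k) => [<-|ik].
  by rewrite !dfwithin.
by rewrite !dfwithout.
Qed.

Lemma dfwithC g i j x y : i != j ->
  dfwith (dfwith g i x) j y = dfwith (dfwith g j y) i x.
Proof.
move=> ij; apply: profileP => k; case: (eqVneq i k) => [<-|ik].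
  by rewrite dfwithin dfwithout 1?eq_sym // dfwithin.
case: (eqVneq j k) => [<-|jk]; first by rewrite dfwithin dfwithout // dfwithin.
by rewrite !dfwithout.
Qed.

Lemma gain_shift0 i t a g : @gain_shift i t a 0 g = g.
Proof. by rewrite /gain_shift scale0r addr0 dfwith_id. Qed.

Lemma gain_shiftD i t a r s g :
  @gain_shift i t a r (gain_shift t a s g) = gain_shift t a (s + r) g.
Proof. by rewrite /gain_shift dfwith_dfwith dfwithin -addrA -scalerDl. Qed.

Lemma gain_shift_dfwith i t a s g x :
  @gain_shift i t a s (dfwith g i x) = dfwith g i (x + s *: delta_mx t a).
Proof. by rewrite /gain_shift dfwith_dfwith dfwithin. Qed.

Lemma gain_shift_dfwith_neq i j t a s g x : i != j ->
  @gain_shift i t a s (dfwith g j x) = dfwith (gain_shift t a s g) j x.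
Proof.
move=> ij; have ji : j != i by rewrite eq_sym.
by rewrite /gain_shift [dfwith g j x i]dfwithout // (dfwithC _ _ _ ji).
Qed.

Lemma gain_shiftC i j t a tau b r s g : i != j ->
  @gain_shift i t a r (@gain_shift j tau b s g) =
  gain_shift tau b s (gain_shift t a r g).
Proof.
move=> ij; rewrite {2}/gain_shift gain_shift_dfwith_neq //.
by rewrite {3}/gain_shift /gain_shift dfwithout.
Qed.

(** Since [x - y] is a sum of multiples of the [delta_mx t a], finitely many single-entry moves lead
    from [y] to [x]. *)
Lemma gain_shift_invariant i (F : profile -> R) g x y :
  (forall t a s h, F (@gain_shift i t a s h) = F h) ->
  F (dfwith g i x) = F (dfwith g i y).
Proof.
move=> Finv; rewrite -[x](subrKC y) (matrix_sum_delta (x - y)).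
suff step (r : seq 'I_tf) z : F (dfwith g i (z + \sum_(t <- r) \sum_a
    (x - y) t a *: delta_mx t a)) = F (dfwith g i z) by [].
elim: r z => [|t r IH] z; first by rewrite big_nil addr0.
rewrite big_cons addrA IH.
elim: (index_enum _) => [|a q IHq]; first by rewrite big_nil addr0.
by rewrite big_cons addrCA addrC -gain_shift_dfwith Finv.
Qed.

(** Quadratic in each entry separately: under feedback, gains at successive times multiply, so the
    joint degree can be higher. *)
Definition gain_quadratic F :=
  forall i t a g, quadratic (fun s => F (@gain_shift i t a s g)).

Definition gain_diff i t a F g : R :=
  (F (@gain_shift i t a 1 g) - F (gain_shift t a (-1) g)) / 2.

Lemma partial_gain_diff F i t a : gain_quadratic F ->
  @partial R N n tf I F i t a = @gain_diff i t a F.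
Proof.
move=> Fq; apply/funext => g; rewrite /partial derive_quadratic //.
  by rewrite /gain_diff /gain_shift scale1r scaleN1r.
exact: Fq.
Qed.

(** Moves of distinct agents commute, so the difference combines two functions quadratic in [s];
    [derive_quadratic] then applies a second time. *)
Lemma quadratic_gain_diff F i j t a tau b g : gain_quadratic F -> i != j ->
  quadratic (fun s => @gain_diff i t a F (@gain_shift j tau b s g)).
Proof.
move=> Fq ij s; rewrite /gain_diff !(gain_shiftC t a tau b _ _ _ ij).
rewrite (Fq j tau b (gain_shift t a 1 g) s).
rewrite (Fq j tau b (gain_shift t a (-1) g) s).
by field.
Qed.

Lemma partial_partial F i j t a tau b : gain_quadratic F -> i != j ->
  partial (@partial R N n tf I F i t a) tau b =
  @gain_diff j tau b (@gain_diff i t a F).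
Proof.
move=> Fq ij; rewrite (partial_gain_diff t a Fq); apply/funext => g.
rewrite /partial derive_quadratic.
  by rewrite /gain_diff /gain_shift !scale1r !scaleN1r.
exact: (@quadratic_gain_diff F i j).
Qed.

End Shift.

(** * Separation of variables and construction of the potential *)

Section Potential.
Variables (R : realType) (N n tf : nat) (I : info_structure N n).
Local Notation profile := (profile R tf I).
Implicit Types (g : profile) (F : profile -> R).

Lemma gain_diff_eq0 F i t a :
  (forall g, quadratic (fun s => F (@gain_shift R N n tf I i t a s g))) ->
  (forall g, gain_diff t a F g = 0) ->
  forall s g, F (gain_shift t a s g) = F g.
Proof.
move=> Fq F0 s g; rewrite -[in RHS](gain_shift0 t a g).
apply: (quadratic_stationary (Fq g)) => {}s.
have := F0 (gain_shift t a s g); rewrite /gain_diff !gain_shiftD; lra.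
Qed.

(** The vanishing mixed difference is integrated along one entry of each agent, then single-entry
    moves are assembled into changes of whole gains. *)
Lemma separable F i j g x x' y y' :
  gain_quadratic F -> i != j ->
  (forall t tau a b h, @gain_diff R N n tf I j tau b
     (@gain_diff R N n tf I i t a F) h = 0) ->
  F (dfwith (dfwith g j y) i x) - F (dfwith (dfwith g j y) i x') =
  F (dfwith (dfwith g j y') i x) - F (dfwith (dfwith g j y') i x').
Proof.
move=> Fq ij F0; have ji : j != i by rewrite eq_sym.
have diff_const t a tau b s h :
    @gain_diff R N n tf I i t a F (@gain_shift R N n tf I j tau b s h) =
    gain_diff t a F h.
  by apply: gain_diff_eq0 => // {}h; exact: quadratic_gain_diff.
(* The roles are exchanged: the increment of [F] under a move of agent [j] has zero central
   differences in the entries of agent [i]. *)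
have shift_const tau b r t a s h :
    F (@gain_shift R N n tf I j tau b r (@gain_shift R N n tf I i t a s h)) -
    F (gain_shift t a s h) = F (gain_shift tau b r h) - F h.
  apply: (gain_diff_eq0
    (F := fun h => F (@gain_shift R N n tf I j tau b r h) - F h)).
    move=> k u; rewrite !(gain_shiftC tau b t a _ _ _ ji).
    rewrite (Fq i t a (gain_shift tau b r k) u) (Fq i t a k u).
    by field.
  move=> k; have := diff_const t a tau b r k.
  by rewrite /gain_diff !(gain_shiftC tau b t a _ _ _ ji); lra.
(* [E] is unchanged by each entry move of [j] because the increments in [shift_const] do not depend
   on the gain of [i]. *)
pose E k := F (dfwith k i x) - F (dfwith k i x').
rewrite -/(E _) -/(E _); apply: gain_shift_invariant => tau b r h.
have := @gain_shift_invariant R N n tf I i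
  (fun h => F (@gain_shift R N n tf I j tau b r h) - F h) h x x'
  (fun t a s => shift_const tau b r t a s).
by rewrite /E !gain_shift_dfwith_neq //; lra.
Qed.

Definition first_gains g (m : nat) : profile :=
  fun k => if (k < m)%N then g k else 0.

(** Only stages after agent [k] has switched see its gain [x]; before, it is still 0. The nested
    [dfwith] matches the four-cycle hypothesis of [candidate_potentialP]. *)
Lemma first_gains_dfwith g i k (x : 'M[R]_(tf, qdim I k)) : i != k ->
  first_gains (dfwith g k x) i.+1 =
  dfwith (dfwith (first_gains g i) k (if (k < i)%N then x else 0)) i (g i).
Proof.
move=> ik; apply: profileP => l; rewrite /first_gains ltnS.
case: (eqVneq i l) => [<-|il]; first by
  rewrite leqnn dfwithin dfwithout // eq_sym.
rewrite [RHS]dfwithout //; case: (eqVneq k l) => [<-|kl].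
  by rewrite !dfwithin leq_eqVlt val_eqE [k == i]eq_sym (negbTE ik).
by rewrite !dfwithout // leq_eqVlt val_eqE [l == i]eq_sym (negbTE il).
Qed.

Lemma first_gains_dfwith0 g i k (x : 'M[R]_(tf, qdim I k)) : i != k ->
  first_gains (dfwith g k x) i =
  dfwith (dfwith (first_gains g i) k (if (k < i)%N then x else 0)) i 0.
Proof.
move=> ik; apply: profileP => l; rewrite /first_gains.
case: (eqVneq i l) => [<-|il]; first by rewrite ltnn dfwithin.
rewrite [RHS]dfwithout //; case: (eqVneq k l) => [<-|kl].
  by rewrite !dfwithin.
by rewrite !dfwithout.
Qed.

Definition candidate_potential (J : 'I_N -> profile -> R) g : R :=
  \sum_(i < N) (J i (first_gains g i.+1) - J i (first_gains g i)).

(** The change of [J k] telescopes along the same switching path, and the four-cycle condition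
    matches it with the change of the potential stage by stage. *)
Lemma candidate_potentialP (J : 'I_N -> profile -> R) :
  (forall i k, i != k -> forall g x x' y y',
     let D g := J i g - J k g in
     D (dfwith (dfwith g k y) i x) - D (dfwith (dfwith g k y) i x') =
     D (dfwith (dfwith g k y') i x) - D (dfwith (dfwith g k y') i x')) ->
  forall k g x y,
    J k (dfwith g k x) - J k (dfwith g k y) =
    candidate_potential J (dfwith g k x) - candidate_potential J (dfwith g k y).
Proof.
move=> Jsep k g x y; rewrite /candidate_potential -sumrB.
pose A m := J k (first_gains (dfwith g k x) m) -
            J k (first_gains (dfwith g k y) m).
have full z : first_gains (dfwith g k z) N = dfwith g k z.
  by apply: profileP => l; rewrite /first_gains ltn_ord.
have -> : J k (dfwith g k x) - J k (dfwith g k y) = A N - A 0%N.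
  by rewrite /A !full subrr subr0.
rewrite -(telescope_sumr A (leq0n N)) big_mkord; apply: eq_bigr => i _.
(* At stage [k] both sides charge [J k]; at any other stage [i] they differ by a four-cycle of
   [J i - J k]. *)
rewrite /A; case: (eqVneq i k) => [->|ik]; first by ring.
rewrite !first_gains_dfwith // !first_gains_dfwith0 //.
have := Jsep i k ik (first_gains g i) (g i) 0
  (if (k < i)%N then x else 0) (if (k < i)%N then y else 0).
rewrite /=; lra.
Qed.

End Potential.

(** * Quadratic dependence of costs and losses on one gain entry *)

Lemma Rintegral_comb3 d (T : measurableType d) (R : realType)
    (mu : {measure set T -> \bar R}) (c0 c1 c2 : R) (f0 f1 f2 : T -> R) :
  mu.-integrable setT (EFin \o f0) -> mu.-integrable setT (EFin \o f1) ->
  mu.-integrable setT (EFin \o f2) ->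
  \int[mu]_x (c0 * f0 x + c1 * f1 x + c2 * f2 x) =
  c0 * \int[mu]_x f0 x + c1 * \int[mu]_x f1 x + c2 * \int[mu]_x f2 x.
Proof.
move=> i0 i1 i2.
have intZ (c : R) (f : T -> R) : mu.-integrable setT (EFin \o f) ->
    mu.-integrable setT (EFin \o (fun x => c * f x)).
  move=> /(integrableZl measurableT c).
  by apply: eq_integrable => // x _; rewrite /= EFinM.
have i01 : mu.-integrable setT (EFin \o (fun x => c0 * f0 x + c1 * f1 x)).
  have := integrableD measurableT (intZ c0 _ i0) (intZ c1 _ i1).
  by apply: eq_integrable => // x _; rewrite /= EFinD.
by rewrite !RintegralD ?RintegralZl //; exact: intZ.
Qed.

Section Cost.
Variables (R : realType) (N n tf : nat) (G : lq_game R N n tf).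
Variable I : info_structure N n.
Local Notation profile := (profile R tf I).
Local Notation shift := (@gain_shift R N n tf I).
Implicit Types (g : profile).

Lemma submxcol_affine (m : 'I_N -> nat) (x v : 'cV[R]_(\sum_i m i)) s i :
  submxcol (x + s *: v) i = submxcol x i + s *: submxcol v i.
Proof. by apply/matrixP => a b; rewrite !mxE. Qed.

(** Subtracting [action K 0] leaves the linear part: an open-loop input is constant in the state. *)
Lemma action_state_affine i (K : 'rV[R]_(qdim I i)) (x v : 'cV[R]_n) s :
  action K (x + s *: v) = action K x + s * (action K v - action K 0).
Proof.
have rvE p (k : 'rV[R]_p) (u w : 'cV[R]_p) :
    (k *m (u + s *: w)) ord0 ord0 =
    (k *m u) ord0 ord0 + s * (k *m w) ord0 ord0.
  by rewrite mulmxDr -scalemxAr !mxE.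
have rv0 p (k : 'rV[R]_p) : (k *m (0 : 'cV[R]_p)) ord0 ord0 = 0.
  by rewrite mulmx0 mxE.
case: I K => [K|K|m e K] /=; first by ring.
  by rewrite rvE rv0; ring.
case: n / e x v K => x v K; rewrite !castmx_id submxcol_affine rvE.
have -> : submxcol (0 : 'cV[R]_(\sum_i m i)) i = 0.
  by apply/matrixP => a b; rewrite !mxE.
by rewrite rv0; ring.
Qed.

Lemma action_gain_affine i (K L : 'rV[R]_(qdim I i)) (x : 'cV[R]_n) s :
  action (K + s *: L) x = action K x + s * action L x.
Proof.
have rvE p (k l : 'rV[R]_p) (u : 'cV[R]_p) :
    ((k + s *: l) *m u) ord0 ord0 =
    (k *m u) ord0 ord0 + s * (l *m u) ord0 ord0.
  by rewrite mulmxDl -scalemxAl !mxE.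
case: I K L => [K L|K L|m e K L] /=; first by rewrite !mxE.
  by rewrite rvE; ring.
by rewrite rvE; ring.
Qed.

(** The gain moves only at time [t], when the state has not moved yet; at other times only the state
    moves. Hence no term in [s ^+ 2] arises. *)
Lemma control_shift i (t : 'I_tf) a g (x v : 'cV[R]_n) j r :
  ((r <= t)%N -> v = 0) ->
  exists c, ((r < t)%N -> c = 0) /\ forall s,
    control (@shift i t a s g) j r (x + s *: v) = control g j r x + s * c.
Proof.
rewrite /control; case: insubP => [u _ <- {r}|rtf v0]; last first.
  (* Beyond the horizon [control] takes its default value 0. *)
  by exists 0; split=> // s; rewrite mulr0 addr0.
move=> v0; have [ut|ut] := eqVneq u t.
  rewrite ut in v0 *; rewrite v0 //; have [ji|ij] := eqVneq j i.
    subst j; exists (action (row t (delta_mx t a)) x); rewrite ltnn; split=> // s.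
    rewrite scaler0 addr0 /gain_shift dfwithin linearD linearZ /=.
    exact: action_gain_affine.
  exists 0; split=> // s.
  by rewrite scaler0 addr0 mulr0 addr0 /gain_shift dfwithout // eq_sym.
exists (action (row u (g j)) v - action (row u (g j)) 0); split=> [/ltnW/v0->|s].
  by rewrite subrr.
suff -> : row u (@shift i t a s g j) = row u (g j) by exact: action_state_affine.
rewrite /gain_shift; case: dfwithP => // {j}.
by apply/rowP => l; rewrite !mxE (negbTE ut) mulr0 addr0.
Qed.

Lemma state_shift i (t : 'I_tf) a g z r :
  exists v, ((r <= t)%N -> v = 0) /\ forall s,
    state G (@shift i t a s g) z r = state G g z r + s *: v.
Proof.
elim: r => [|r [v [v0 vE]]]; first by exists 0; split=> // s; rewrite scaler0 addr0.
have /choice[c cP] := fun j => @control_shift i t a g (state G g z r) v j r v0.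
(* The direction propagates through the dynamics. The input at time [t] first affects the state at
   [t.+1], so the direction stays 0 up to [t] itself. *)
exists (dynA G *m v + \sum_j c j *: dynB G j); split=> [rt|s].
  rewrite v0 1?ltnW // mulmx0 add0r big1 // => j _.
  by rewrite (proj1 (cP j)) // scale0r.
rewrite /= vE mulmxDr -scalemxAr scalerDr scaler_sumr addrACA -big_split /=.
congr (_ + _); apply: eq_bigr => j _.
by rewrite (proj2 (cP j)) scalerDl scalerA.
Qed.

Lemma input_shift i (t : 'I_tf) a g z j r :
  exists c, forall s,
    input G (@shift i t a s g) z j r = input G g z j r + s * c.
Proof.
have [v [v0 vE]] := @state_shift i t a g z r.
have [c [_ cE]] := @control_shift i t a g (state G g z r) v j r v0.
by exists c => s; rewrite /input vE cE.
Qed.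

Lemma qform_quadratic (Q : 'M[R]_n) (x v : 'cV[R]_n) :
  quadratic (fun s => qform Q (x + s *: v)).
Proof.
(* The two cross terms may differ, as [Q] may be non-symmetric. *)
apply/quadraticP; exists (qform Q x),
  ((v^T *m Q *m x) ord0 ord0 + (x^T *m Q *m v) ord0 ord0), (qform Q v) => s.
rewrite /qform; have -> : (x + s *: v)^T = x^T + s *: v^T by rewrite linearD linearZ.
rewrite !mulmxDl !mulmxDr -!scalemxAl -!scalemxAr.
move: (x^T *m Q *m x) (v^T *m Q *m x) (x^T *m Q *m v) (v^T *m Q *m v).
by move=> a b c d; rewrite !mxE; ring.
Qed.

Lemma pathwise_cost_quadratic k x0 :
  gain_quadratic (fun g : profile => pathwise_cost G k g x0).
Proof.
move=> i t a g; rewrite /pathwise_cost /=.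
apply: quadraticD; apply: quadratic_sum => r.
  have [v [_ vE]] := @state_shift i t a g (\col_l tnth x0 l) r.
  under eq_fun do rewrite vE addrAC.
  exact: qform_quadratic.
apply: quadratic_sum => j; apply: quadratic_sum => h.
have [c cE] := @input_shift i t a g (\col_l tnth x0 l) j r.
have [d dE] := @input_shift i t a g (\col_l tnth x0 l) h r.
pose u := input G g; pose z : 'cV[R]_n := \col_l tnth x0 l.
apply/quadraticP; exists (u z j r * Rcost G k r j h * u z h r),
  (c * Rcost G k r j h * u z h r + u z j r * Rcost G k r j h * d),
  (c * Rcost G k r j h * d) => s.
by rewrite cE dE /u /z; ring.
Qed.

(* Quadratic functions are recovered from their values at 0, 1 and -1, so only the
   integrability of pathwise costs is needed, not that of their coefficients. *)
Lemma loss_quadratic k :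
  real_valued_losses G I -> gain_quadratic (loss G (I:=I) k).
Proof.
move=> /(_ k) intJ i t a g s.
have lossE (h : profile) : loss G k h = \int[init_law G]_x pathwise_cost G k h x.
  by rewrite /loss unlock.
rewrite !lossE; pose p (h : profile) : n.-tuple R -> R := pathwise_cost G k h.
transitivity (\int[init_law G]_x ((1 - s ^+ 2) * p (@shift i t a 0 g) x
   + (s + s ^+ 2) / 2 * p (@shift i t a 1 g) x
   + (s ^+ 2 - s) / 2 * p (@shift i t a (-1) g) x)).
  apply: eq_Rintegral => x _; rewrite (pathwise_cost_quadratic k x).
  by rewrite /p; field.
by rewrite Rintegral_comb3 ?/p; [field|exact: intJ..].
Qed.

End Cost.

(** * Hessian symmetry and existence of a potential *)

Theorem lemma4 (R : realType) (N n tf : nat) (G : lq_game R N n tf)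
    (I : info_structure N n) (htf : (0 < tf)%N)
    (hJ : real_valued_losses G I) :
  potential_game G I <->
  (forall (i j : 'I_N) (t tau : 'I_tf) (g : profile R tf I),
     mixed_hessian (loss G (I:=I) i) j tau i t g =
     mixed_hessian (loss G (I:=I) j) j tau i t g).
Proof.
have Jq k : gain_quadratic (loss G (I:=I) k) by exact: loss_quadratic.
split=> [[Pi PiE] i j t tau g|hess].
  have [<-//|ij] := eqVneq i j.
  apply/matrixP => a b; rewrite !mxE !partial_partial // /gain_diff.
  have JPi k (s : 'I_tf) (c : 'I_(qdim I k)) h :
      loss G k (gain_shift s c 1 h) - loss G k (gain_shift s c (-1) h) =
      Pi (gain_shift s c 1 h) - Pi (gain_shift s c (-1) h) by exact: PiE.
  (* [Pi] replaces [J^i] in differences along [i], but [J^j] only in differences along [j].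
     Commuting the moves regroups the four corners accordingly. *)
  rewrite !JPi !(gain_shiftC t a tau b _ _ _ ij).
  have := JPi j tau b (gain_shift t a 1 g).
  have := JPi j tau b (gain_shift t a (-1) g).
  lra.
exists (candidate_potential (loss G (I:=I))).
apply: candidate_potentialP => i k ik g x x' y y' D.
apply: separable => // [u v c h s|t tau a b h].
  by rewrite /D !(Jq _ _ _ _ _ s); field.
(* Differences are linear in the function, so equal Hessian entries make the mixed difference of [D]
   vanish. *)
have /matrixP/(_ a b) := hess i k t tau h.
rewrite !mxE !partial_partial // /D /gain_diff; lra.
Qed.
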